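(* Let $(A,\rho,b,\lambda)\in\mathbb{R}^{m\times n}\times[0,1)\times\mathbb{R}^{2m}\times\mathbb{R}_{++}$ with $b=(y^\top,r^\top)^\top$, and let $S_p$, $S_d$, $S_e$ be the primal, dual and extended solution sets of the sGMC model with these parameters. Then $S_p$, $S_d$ and $S_e$ are all nonempty, closed, convex and bounded. Moreover: (a) For all $x_1,x_2\in S_p$, $Ax_1=Ax_2$ and $\|x_1\|_1=\|x_2\|_1$; for all $z_1,z_2\in S_d$, $Az_1=Az_2$ and $\|z_1\|_1=\|z_2\|_1$. (b) If $A$ has columns in general position, then the primal solution $x\in S_p$ and the dual solution $z\in S_d$ are both unique, each with at most $\min\{m,n\}$ nonzero components. (c) For every $x\in S_p$ and every $z\in S_d$, $$\max\{\|x\|_1,\|z\|_1\}\le \frac{\|y\|_2^2}{2\lambda(1-\rho)}+\frac{\|r\|_2^2}{2\lambda}.$$ (d) Let $\beta_p:=Ax$ for $x\in S_p$ and $\beta_d:=Az$ for $z\in S_d$ (well defined by (a)). Then $$S_e=S_p\times S_d=S_{LA}\!\left(A,\frac{y-\rho\beta_d}{1-\rho},\frac{\lambda}{1-\rho}\right)\times S_{LA}\!\left(\sqrt{\rho}A,\ r+\sqrt{\rho}\beta_p,\ \lambda\right).$$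
   Context: Here $\mathbb{R}_{++}=(0,\infty)$, $m,n$ are positive integers, and $y,r\in\mathbb{R}^m$. The sGMC model. Define, for $x,z\in\mathbb{R}^n$, $$G(x,z)=\tfrac12\|y-Ax\|_2^2+\lambda\|x\|_1-\lambda\|z\|_1-\tfrac{\rho}{2}\|Ax-Az\|_2^2+\sqrt{\rho}\,r^\top Az .$$ The primal solution set $S_p$ is the set of minimizers over $x\in\mathbb{R}^n$ of $\max_{z\in\mathbb{R}^n}G(x,z)$. The dual solution set $S_d$ is the set of minimizers over $z\in\mathbb{R}^n$ of $-\min_{x\in\mathbb{R}^n}G(x,z)$. The extended solution set $S_e\subset\mathbb{R}^{2n}$ is the set of $w=(x^\top,z^\top)^\top$ such that $(x,z)$ is a saddle point of $\min_x\max_z G$, i.e. $G(x,z')\le G(x,z)\le G(x',z)$ for all $x',z'\in\mathbb{R}^n$. LASSO solution set. For $A'\in\mathbb{R}^{m\times n}$, $y'\in\mathbb{R}^m$, $\lambda'>0$, $S_{LA}(A',y',\lambda')$ is the set of minimizers over $x\in\mathbb{R}^n$ of $\tfrac12\|y'-A'x\|_2^2+\lambda'\|x\|_1$. General position. $A=[a_1,\dots,a_n]$ has columns in general position if for every $I\subset\{1,\dots,n\}$ with $|I|\le m$, every $i\in\{1,\dots,n\}\setminus I$, and all signs $(s_j)_{j\in I\cup\{i\}}\subset\{+1,-1\}$, one has $s_ia_i\notin\mathrm{aff}\{s_ja_j\}_{j\in I}$ (affine hull; the affine hull of the empty set is empty). *)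

(* Defs.v *)
From HB Require Import structures.
From mathcomp Require Import all_boot all_order all_algebra.
From mathcomp Require Import all_classical all_reals all_analysis.

Set Implicit Arguments.
Unset Strict Implicit.
Unset Printing Implicit Defensive.

Import Order.TTheory GRing.Theory Num.Theory.
Import numFieldNormedType.Exports.

Local Open Scope classical_set_scope.
Local Open Scope ring_scope.

Definition l1norm (R : realType) (n : nat) (x : 'cV[R]_n) : R :=
  \sum_(i < n) `|x i 0|.

Definition l2norm (R : realType) (n : nat) (x : 'cV[R]_n) : R :=
  Num.sqrt (\sum_(i < n) x i 0 ^+ 2).

Definition nnz (R : realType) (n : nat) (x : 'cV[R]_n) : nat :=
  #|[pred i | x i 0 != 0]|.

Definition argmin (T : Type) (d : Order.disp_t) (V : porderType d)
    (f : T -> V) : set T :=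
  [set x | forall x', (f x <= f x')%O].

Definition saddle_point (R : realType) (X Z : Type) (f : X -> Z -> R)
    (x : X) (z : Z) : Prop :=
  (forall z', f x z' <= f x z) /\ (forall x', f x z <= f x' z).

(* The product of two subsets of R^n, as a subset of R^(n + n). *)
Definition stackX (R : realType) (n : nat) (P Q : set 'cV[R]_n) :
    set 'cV[R]_(n + n) :=
  [set w | P (usubmx w) /\ Q (dsubmx w)].

Definition sGMC (R : realType) (m n : nat) (A : 'M[R]_(m, n)) (rho : R)
    (y r : 'cV[R]_m) (lambda : R) (x z : 'cV[R]_n) : R :=
  2^-1 * l2norm (y - A *m x) ^+ 2 + lambda * l1norm x - lambda * l1norm z
  - rho / 2 * l2norm (A *m x - A *m z) ^+ 2
  + Num.sqrt rho * (r^T *m A *m z) 0 0.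

(* The inner max and min are taken in the extended reals, so that both
   objectives are total before attainment is known. *)
Definition primal_sol (R : realType) (m n : nat) (A : 'M[R]_(m, n)) (rho : R)
    (y r : 'cV[R]_m) (lambda : R) : set 'cV[R]_n :=
  argmin (fun x => ereal_sup (range (fun z => (sGMC A rho y r lambda x z)%:E))).

Definition dual_sol (R : realType) (m n : nat) (A : 'M[R]_(m, n)) (rho : R)
    (y r : 'cV[R]_m) (lambda : R) : set 'cV[R]_n :=
  argmin (fun z =>
    (- ereal_inf (range (fun x => (sGMC A rho y r lambda x z)%:E)))%E).

Definition extended_sol (R : realType) (m n : nat) (A : 'M[R]_(m, n)) (rho : R)
    (y r : 'cV[R]_m) (lambda : R) : set 'cV[R]_(n + n) :=
  [set w | saddle_point (sGMC A rho y r lambda) (usubmx w) (dsubmx w)].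

Definition lasso_sol (R : realType) (m n : nat) (A : 'M[R]_(m, n))
    (y : 'cV[R]_m) (lambda : R) : set 'cV[R]_n :=
  argmin (fun x => 2^-1 * l2norm (y - A *m x) ^+ 2 + lambda * l1norm x).

(* Affine hull of the family (p j), j in I; it is empty when I is, since an
   empty sum of coefficients is not 1. *)
Definition aff_hull (R : realType) (m n : nat) (I : {set 'I_n})
    (p : 'I_n -> 'cV[R]_m) : set 'cV[R]_m :=
  [set v | exists c : 'I_n -> R,
     \sum_(j in I) c j = 1 /\ v = \sum_(j in I) c j *: p j].

(* The sign of column j is (-1) ^+ s j; the values of s outside I and i play
   no role. *)
Definition general_position (R : realType) (m n : nat) (A : 'M[R]_(m, n)) :
    Prop :=
  forall (I : {set 'I_n}) (i : 'I_n) (s : 'I_n -> bool),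
    (#|I| <= m)%N -> i \notin I ->
    ~ aff_hull I (fun j => (-1) ^+ s j *: col j A) ((-1) ^+ s i *: col i A).

(* Main.v *)
Require Import Defs.
From HB Require Import structures.
From mathcomp Require Import all_boot all_order all_algebra.
From mathcomp Require Import ring lra.
From mathcomp Require Import all_classical all_reals all_analysis.

(** Everything is reduced to LASSO problems, and LASSO problems are handled
    through one variational inequality ([lassoP]): [x] solves the LASSO with
    data [A, y, l] iff
      dot (y - A x) (A x' - A x) <= l (|x'|_1 - |x|_1)   for all x'.
    Two solutions therefore share their fit and their l1 norm, and the solution
    set is convex; it is nonempty and closed because the objective is coercive
    and continuous.

    For fixed [z], the saddle function [G x z] is, up to a constant, (1 - rho)
    times the LASSO objective of [primal_lasso (A z)]; for fixed [x], it is a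
    constant minus the LASSO objective of [dual_lasso (A x)].  Hence [(x, z)] is
    a saddle point iff [x] and [z] solve each other's LASSO ([saddle_pointP]).

    A saddle point is built from a minimizer of the primal objective
    ([saddle_point_ex]), which is
      P x = |y - A x|^2 / 2 + l |x|_1 + sqrt rho <r, A x> + cst - V x,
    where [V x] is the optimal value of the dual LASSO at [x].  That value is
    convex in its data, with the residual as gradient ([lasso_value_lin]).
    So [P] is continuous and coercive and has a minimizer x0, and linearizing
    [V] at x0 yields a majorant of [P] that touches it at x0 and is itself a
    LASSO objective.  Thus x0 minimizes that LASSO, and its variational
    inequality is word for word the one of [primal_lasso (A z0)], for z0 a
    solution of the dual LASSO at x0.

    Once a saddle point exists, saddle points are exactly the pairs of a primal
    and a dual solution ([saddle_point_argmin]).  The fit being the same over a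
    LASSO solution set, this gives [Sp = primal_lasso (A z)] and
    [Sd = dual_lasso (A x)] for any solutions [x] and [z].  The norm bound is
    [G x 0 <= G 0 z] with squares completed.  In general position, the columns
    that attain the extreme correlation with the common residual are linearly
    independent ([general_position_free]); all solutions are supported on them,
    which gives uniqueness and sparsity. *)

Import Order.TTheory GRing.Theory Num.Theory.
Import numFieldNormedType.Exports.

Set Implicit Arguments.
Unset Strict Implicit.
Unset Printing Implicit Defensive.

Local Open Scope classical_set_scope.
Local Open Scope ring_scope.

(** * Inner product and l1 norm *)

Definition dot (R : realType) (m : nat) (u v : 'cV[R]_m) : R :=
  (u^T *m v) 0 0.

Lemma dotE (R : realType) (m : nat) (u v : 'cV[R]_m) :
  dot u v = \sum_i u i 0 * v i 0.
Proof. by rewrite /dot mxE; apply: eq_bigr => i _; rewrite mxE. Qed.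

Lemma dotC (R : realType) (m : nat) (u v : 'cV[R]_m) : dot u v = dot v u.
Proof. by rewrite !dotE; apply: eq_bigr => i _; rewrite mulrC. Qed.

Lemma dotDl (R : realType) (m : nat) (u v w : 'cV[R]_m) :
  dot (u + v) w = dot u w + dot v w.
Proof. by rewrite /dot linearD mulmxDl mxE. Qed.

Lemma dotNl (R : realType) (m : nat) (u w : 'cV[R]_m) :
  dot (- u) w = - dot u w.
Proof. by rewrite /dot linearN mulNmx mxE. Qed.

Lemma dotZl (R : realType) (m : nat) (a : R) (u w : 'cV[R]_m) :
  dot (a *: u) w = a * dot u w.
Proof. by rewrite /dot linearZ -scalemxAl mxE. Qed.

Lemma dot0l (R : realType) (m : nat) (w : 'cV[R]_m) : dot 0 w = 0.
Proof. by rewrite /dot linear0 mul0mx mxE. Qed.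

Lemma dotDr (R : realType) (m : nat) (u v w : 'cV[R]_m) :
  dot w (u + v) = dot w u + dot w v.
Proof. by rewrite dotC dotDl !(dotC w). Qed.

Lemma dotNr (R : realType) (m : nat) (u w : 'cV[R]_m) :
  dot w (- u) = - dot w u.
Proof. by rewrite dotC dotNl dotC. Qed.

Lemma dotZr (R : realType) (m : nat) (a : R) (u w : 'cV[R]_m) :
  dot w (a *: u) = a * dot w u.
Proof. by rewrite dotC dotZl dotC. Qed.

Lemma dot0r (R : realType) (m : nat) (w : 'cV[R]_m) : dot w 0 = 0.
Proof. by rewrite dotC dot0l. Qed.

Definition dot_expand :=
  (dotDl, dotDr, dotNl, dotNr, dotZl, dotZr, dot0l, dot0r).

Lemma dot_ge0 (R : realType) (m : nat) (u : 'cV[R]_m) : 0 <= dot u u.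
Proof. by rewrite dotE sumr_ge0// => i _; rewrite -expr2 sqr_ge0. Qed.

Lemma dot_eq0 (R : realType) (m : nat) (u : 'cV[R]_m) : dot u u <= 0 -> u = 0.
Proof.
move=> u0; have {}u0 : \sum_i u i 0 * u i 0 = 0.
  by rewrite -dotE; apply/eqP; rewrite eq_le u0 dot_ge0.
apply/colP => i; rewrite mxE; apply/eqP; rewrite -sqrf_eq0 expr2; apply/eqP.
by apply: (psumr_eq0P _ u0) => // j _; rewrite -expr2 sqr_ge0.
Qed.

(** The quadratic form is [|y - c u|^2 / c]. *)
Lemma completed_square_ge0 (R : realType) (m : nat) (c : R) (y u : 'cV[R]_m) :
  0 < c -> 0 <= dot y y / c - 2 * dot y u + c * dot u u.
Proof.
move=> c0; have := dot_ge0 (y - c *: u).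
rewrite -(pmulr_rge0 _ (_ : 0 < c^-1)) ?invr_gt0// !dot_expand !(dotC _ y).
by congr (_ <= _); field; rewrite gt_eqF.
Qed.

Lemma sqr_l2norm (R : realType) (m : nat) (u : 'cV[R]_m) :
  l2norm u ^+ 2 = dot u u.
Proof.
rewrite /l2norm sqr_sqrtr ?sumr_ge0// => [|i _]; last exact: sqr_ge0.
by rewrite dotE; apply: eq_bigr => i _; rewrite expr2.
Qed.

Lemma l1norm_ge0 (R : realType) (n : nat) (x : 'cV[R]_n) : 0 <= l1norm x.
Proof. by rewrite sumr_ge0. Qed.

Lemma l1norm0 (R : realType) (n : nat) : l1norm (0 : 'cV[R]_n) = 0.
Proof. by rewrite /l1norm big1// => i _; rewrite mxE normr0. Qed.

Lemma le_coord_l1norm (R : realType) (n : nat) (x : 'cV[R]_n) i :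
  `|x i 0| <= l1norm x.
Proof. by rewrite /l1norm (bigD1 i)//= lerDl sumr_ge0. Qed.

Lemma l1norm_eq0 (R : realType) (n : nat) (x : 'cV[R]_n) :
  l1norm x <= 0 -> x = 0.
Proof.
move=> x0; apply/colP => i; rewrite mxE; apply/eqP; rewrite -normr_le0.
exact: le_trans (le_coord_l1norm x i) x0.
Qed.

Lemma l1norm_convex (R : realType) (n : nat) (x x' : 'cV[R]_n) (t : R) :
  0 <= t <= 1 -> l1norm (x + t *: (x' - x)) <= l1norm x + t * (l1norm x' - l1norm x).
Proof.
move=> /andP[t0 t1].
rewrite /l1norm -sumrB mulr_sumr -big_split /= ler_sum// => i _.
rewrite !mxE.
have -> : x i 0 + t * (x' i 0 - x i 0) = (1 - t) * x i 0 + t * x' i 0 by ring.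
apply: le_trans (ler_normD _ _) _.
rewrite !normrM (ger0_norm t0) (@ger0_norm _ (1 - t)) ?subr_ge0//.
by rewrite le_eqVlt; apply/orP; left; apply/eqP; ring.
Qed.

(** * The LASSO variational inequality *)

Definition lasso (R : realType) (m n : nat) (A : 'M[R]_(m, n))
    (y : 'cV[R]_m) (l : R) (x : 'cV[R]_n) : R :=
  2^-1 * l2norm (y - A *m x) ^+ 2 + l * l1norm x.

Lemma lasso_sub (R : realType) (m n : nat) (A : 'M[R]_(m, n))
    (y : 'cV[R]_m) (l : R) (x x' : 'cV[R]_n) :
  lasso A y l x' - lasso A y l x =
  2^-1 * dot (A *m x' - A *m x) (A *m x' - A *m x)
  - dot (y - A *m x) (A *m x' - A *m x) + l * (l1norm x' - l1norm x).
Proof.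
rewrite /lasso !sqr_l2norm !dot_expand.
rewrite !(dotC _ y) (dotC (A *m x') (A *m x)); lra.
Qed.

(** Replaces the passage to the limit [t -> 0] in the derivation of first-order
    conditions. *)
Lemma le0_of_le_small (R : realType) (c K : R) : 0 <= K ->
  (forall t, 0 < t <= 1 -> c <= t * K) -> c <= 0.
Proof.
move=> K0 cK; rewrite leNgt; apply/negP => c0.
have cK0 : 0 < c + K by lra.
(* At this [t], [t * K < c] as soon as [0 < c]. *)
have /cK : 0 < c / (c + K) <= 1.
  by rewrite divr_gt0//= ler_pdivrMr// mul1r lerDl.
rewrite mulrAC ler_pdivlMr//; nra.
Qed.

(** Necessity is the first-order condition along the segment from [x] to [x'],
    with the convexity of the l1 norm standing in for its derivative.
    Sufficiency drops the quadratic term of [lasso_sub]. *)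
Lemma lassoP (R : realType) (m n : nat) (A : 'M[R]_(m, n))
    (y : 'cV[R]_m) (l : R) (x : 'cV[R]_n) : 0 <= l ->
  lasso_sol A y l x <->
  forall x', dot (y - A *m x) (A *m x' - A *m x) <= l * (l1norm x' - l1norm x).
Proof.
move=> l0; split=> [xmin x'|xvi x'].
- rewrite -subr_le0; apply: (@le0_of_le_small _ _
    (2^-1 * dot (A *m x' - A *m x) (A *m x' - A *m x))).
    by rewrite mulr_ge0 ?dot_ge0// invr_ge0.
  move=> t /andP[t0 t1].
  have := xmin (x + t *: (x' - x)).
  rewrite -/(lasso A y l x) -/(lasso A y l (x + _)) -subr_ge0 lasso_sub.
  have -> : A *m (x + t *: (x' - x)) - A *m x = t *: (A *m x' - A *m x).
    by rewrite mulmxDr -scalemxAr mulmxBr addrAC subrr add0r.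
  have := @l1norm_convex _ _ x x' t; rewrite (ltW t0) t1 => /(_ isT).
  rewrite !(dotZl, dotZr) -lerBlDl => /(ler_wpM2l l0) h g.
  rewrite -(ler_pM2l t0); lra.
- rewrite -/(lasso A y l x) -/(lasso A y l x') -subr_ge0 lasso_sub.
  have := xvi x'; have := dot_ge0 (A *m x' - A *m x); lra.
Qed.

(** Adding the two variational inequalities makes [|A x1 - A x2|^2] nonpositive;
    their right-hand sides then compare the norms both ways. *)
Lemma lasso_sol_fit (R : realType) (m n : nat) (A : 'M[R]_(m, n))
    (y : 'cV[R]_m) (l : R) (x1 x2 : 'cV[R]_n) : 0 < l ->
  lasso_sol A y l x1 -> lasso_sol A y l x2 ->
  A *m x1 = A *m x2 /\ l1norm x1 = l1norm x2.
Proof.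
move=> l0 /(lassoP _ _ _ (ltW l0)) s1 /(lassoP _ _ _ (ltW l0)) s2.
have e : A *m x1 = A *m x2.
  apply/eqP; rewrite -subr_eq0; apply/eqP/dot_eq0.
  have := s1 x2; have := s2 x1; rewrite !dot_expand.
  rewrite (dotC (A *m x1) (A *m x2)); lra.
split=> //; have := s1 x2; have := s2 x1; rewrite e subrr dot0r => a b.
by apply/eqP; rewrite eq_le; apply/andP; split; rewrite -subr_ge0 -(pmulr_rge0 _ l0).
Qed.

Lemma lasso_sol_convex (R : realType) (m n : nat) (A : 'M[R]_(m, n))
    (y : 'cV[R]_m) (l : R) : 0 < l -> convex_set (lasso_sol A y l).
Proof.
move=> l0 x1 x2 t; rewrite !inE => s1 s2.
have [e e1] := lasso_sol_fit l0 s1 s2.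
have -> : conv t x1 x2 = x2 + t%:num *: (x1 - x2) :> 'cV[R]_n.
  by rewrite [LHS]/conv /=; apply/colP => i; rewrite !mxE /unstable.onem; ring.
move=> z; apply: le_trans (s2 z).
rewrite mulmxDr -scalemxAr mulmxBr e subrr scaler0 addr0 lerD2l ler_pM2l//.
apply: le_trans (l1norm_convex _ _ _) _; first by rewrite ge0 le1.
by rewrite e1 subrr mulr0 addr0.
Qed.

(** The optimal value, as a function of the data, is convex with gradient the
    residual, and that gradient is 1-Lipschitz.  The lower bound is the
    variational inequality at [x2]; the upper bound tests the minimality of [x1]
    against [x2]. *)
Lemma lasso_value_lin (R : realType) (m n : nat) (A : 'M[R]_(m, n))
    (y1 y2 : 'cV[R]_m) (l : R) (x1 x2 : 'cV[R]_n) : 0 <= l ->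
  lasso_sol A y1 l x1 -> lasso_sol A y2 l x2 ->
  dot (y2 - A *m x2) (y1 - y2) <= lasso A y1 l x1 - lasso A y2 l x2 <=
  dot (y2 - A *m x2) (y1 - y2) + 2^-1 * dot (y1 - y2) (y1 - y2).
Proof.
move=> l0 s1 s2; apply/andP; split.
- have /lassoP-/(_ l0 x1) := s2.
  have := dot_ge0 ((y1 - A *m x1) - (y2 - A *m x2)).
  rewrite /lasso !sqr_l2norm !dot_expand !(dotC _ y1) !(dotC _ y2).
  rewrite (dotC (A *m x2) (A *m x1)) (dotC y2 y1); lra.
- have := s1 x2.
  rewrite -/(lasso A y1 l x1) -/(lasso A y1 l x2) /lasso !sqr_l2norm !dot_expand.
  rewrite !(dotC _ y1) !(dotC _ y2) (dotC y2 y1); lra.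
Qed.

(** * Continuity and compactness in coordinates *)

Lemma bounded_l1 (R : realType) (n : nat) (S : set 'cV[R]_n) (C : R) :
  (forall x, S x -> l1norm x <= C) -> bounded_set S.
Proof.
move=> SC; exists C; split; first exact: num_real.
move=> M CM x /SC xC.
have xM : l1norm x <= M by apply: le_trans xC (ltW CM).
rewrite /Num.norm /= mx_normrE.
apply/bigmax_leP; split=> [|[i j] _ /=]; first exact: le_trans (l1norm_ge0 x) xM.
by rewrite (ord1 j); exact: le_trans (le_coord_l1norm x i) xM.
Qed.

Lemma continuous_add (R : realType) (V : normedModType R) (T : topologicalType)
    (f g : T -> V) :
  continuous f -> continuous g -> continuous (fun t => f t + g t).
Proof. by move=> cf cg t; apply: cvgD; [exact: cf|exact: cg]. Qed.

Lemma continuous_sub (R : realType) (V : normedModType R) (T : topologicalType)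
    (f g : T -> V) :
  continuous f -> continuous g -> continuous (fun t => f t - g t).
Proof. by move=> cf cg t; apply: cvgB; [exact: cf|exact: cg]. Qed.

Lemma continuous_scale (R : realType) (V : normedModType R) (T : topologicalType)
    (a : R) (f : T -> V) :
  continuous f -> continuous (fun t => a *: f t).
Proof. by move=> cf t; apply: cvgZl_tmp; exact: cf. Qed.

Lemma continuous_mull (R : realType) (T : topologicalType) (a : R) (f : T -> R) :
  continuous f -> continuous (fun t => a * f t).
Proof. by move=> cf t; apply: cvgMl_tmp; exact: cf. Qed.

Lemma continuous_normr (R : realType) (T : topologicalType) (f : T -> R) :
  continuous f -> continuous (fun t => `|f t|).
Proof. by move=> cf t; apply: cvg_norm; exact: cf. Qed.

Lemma continuous_sum (R : realType) (T : topologicalType) (n : nat)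
    (f : 'I_n -> T -> R) :
  (forall i, continuous (f i)) -> continuous (fun t => \sum_i f i t).
Proof.
by move=> cf; apply: continuous_big => //; exact: add_continuous.
Qed.

Lemma continuous_coordwise (R : realType) (T : topologicalType) (p q : nat)
    (f : T -> 'M[R]_(p, q)) :
  (forall i j, continuous (fun t => f t i j)) -> continuous f.
Proof.
move=> cf t; apply/cvgrPdist_lt => e e0.
have H : \forall t' \near t, forall ij, `|f t ij.1 ij.2 - f t' ij.1 ij.2| < e.
  apply: filter_forall => ij.
  by have /cvgrPdist_lt := cf ij.1 ij.2 t; exact.
apply: filterS H => t' ft.
rewrite /Num.norm /= mx_normrE; apply/bigmax_ltP; split=> // ij _.
by rewrite !mxE; exact: ft.
Qed.

Lemma continuous_mulmx (R : realType) (p q k : nat) (A : 'M[R]_(p, q)) :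
  continuous (fun x : 'M[R]_(q, k) => A *m x).
Proof.
apply: continuous_coordwise => i j.
have -> : (fun x : 'M[R]_(q, k) => (A *m x) i j) =
          (fun x => \sum_l A i l * x l j) by apply/funext => x; rewrite mxE.
apply: continuous_sum => l; apply: continuous_mull; exact: coord_continuous.
Qed.

Lemma continuous_trmx (R : realType) (p q : nat) :
  continuous (@trmx R p q).
Proof.
apply: continuous_coordwise => i j.
have -> : (fun x : 'M[R]_(p, q) => x^T i j) = (fun x => x j i).
  by apply/funext => x; rewrite mxE.
exact: coord_continuous.
Qed.

Lemma continuous_dot (R : realType) (T : topologicalType) (m : nat)
    (f g : T -> 'cV[R]_m) :
  continuous f -> continuous g -> continuous (fun t => dot (f t) (g t)).
Proof.
move=> cf cg; under eq_fun do rewrite dotE.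
apply: continuous_sum => i t; apply: cvgM.
- apply: (continuous_comp (cf t) (@coord_continuous _ _ _ i 0 (f t))).
- apply: (continuous_comp (cg t) (@coord_continuous _ _ _ i 0 (g t))).
Qed.

Lemma continuous_l1norm (R : realType) (n : nat) :
  continuous (@l1norm R n).
Proof.
apply: continuous_sum => i; apply: continuous_normr; exact: coord_continuous.
Qed.

Lemma continuous_lasso (R : realType) (m n : nat) (A : 'M[R]_(m, n))
    (y : 'cV[R]_m) (l : R) : continuous (lasso A y l).
Proof.
rewrite /lasso; under eq_fun do rewrite sqr_l2norm.
have c : continuous (fun x => y - A *m x).
  by apply: continuous_sub; [exact: cst_continuous|exact: continuous_mulmx].
apply: continuous_add; apply: continuous_mull.
  exact: continuous_dot.
exact: continuous_l1norm.
Qed.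

(** * Topology of LASSO solution sets *)

(** The sublevel set of [f 0] lies in an l1 ball.  That ball is handled as a set
    of row vectors, where closed bounded sets are compact. *)
Lemma coercive_min (R : realType) (n : nat) (f : 'cV[R]_n -> R) (l C : R) :
  0 < l -> continuous f -> (forall x, l * l1norm x - C <= f x) ->
  argmin f !=set0.
Proof.
move=> l0 cf fC; pose K := [set u : 'rV[R]_n | l1norm u^T <= (f 0 + C) / l].
have cT : continuous (fun u : 'rV[R]_n => l1norm u^T).
  move=> u; apply: (continuous_comp (@continuous_trmx R _ _ u)).
  exact: continuous_l1norm.
have C0 : 0 <= f 0 + C by have := fC 0; rewrite l1norm0; lra.
have K0 : K 0 by rewrite /K /= trmx0 l1norm0 divr_ge0// ltW.
have cK : compact K.
  apply: bounded_closed_compact.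
  - exists ((f 0 + C) / l); split; first exact: num_real.
    move=> M CM u /= Ku; have uM := le_trans Ku (ltW CM).
    rewrite /Num.norm /= mx_normrE.
    apply/bigmax_leP; split=> [|[i j] _ /=]; first exact: le_trans (l1norm_ge0 _) uM.
    rewrite (ord1 i); have := le_trans (le_coord_l1norm u^T j) uM.
    by rewrite mxE.
  - have /continuous_closedP h := cT.
    exact: (h _ (@closed_le R ((f 0 + C) / l))).
have cfT : {within K, continuous (fun u : 'rV[R]_n => f u^T)}.
  apply: continuous_subspaceT => u.
  exact: (continuous_comp (@continuous_trmx R _ _ u) (cf _)).
have [u uK umin] := EVT_min_rV (ex_intro _ _ K0) cK cfT.
exists u^T => x; have [xK|xK] := pselect (K x^T).
  by have := umin _ (mem_set xK); rewrite trmxK.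
have /le_trans -> // : f u^T <= f 0.
  by have := umin _ (mem_set K0); rewrite trmx0.
apply: le_trans (fC x); move/negP: xK; rewrite /K /= trmxK -ltNge.
by rewrite ltr_pdivrMr// mulrC => h; lra.
Qed.

Lemma le_lasso (R : realType) (m n : nat) (A : 'M[R]_(m, n))
    (y : 'cV[R]_m) (l : R) x : l * l1norm x <= lasso A y l x.
Proof. by rewrite /lasso lerDr mulr_ge0// ?invr_ge0// sqr_ge0. Qed.

Lemma lasso_sol_neq0 (R : realType) (m n : nat) (A : 'M[R]_(m, n))
    (y : 'cV[R]_m) (l : R) : 0 < l -> lasso_sol A y l !=set0.
Proof.
move=> l0; apply: (@coercive_min _ _ _ l 0) => //.
  exact: continuous_lasso.
by move=> x; rewrite subr0; exact: le_lasso.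
Qed.

Lemma lasso_sol_closed (R : realType) (m n : nat) (A : 'M[R]_(m, n))
    (y : 'cV[R]_m) (l : R) : closed (lasso_sol A y l).
Proof.
have -> : lasso_sol A y l =
  \bigcap_x' (lasso A y l @^-1` [set v | v <= lasso A y l x']).
  by apply/seteqP; split=> x s x'; [move=> _|]; exact: s.
apply: closed_bigI => x' _.
have /continuous_closedP h := @continuous_lasso R m n A y l.
exact: (h _ (@closed_le R (lasso A y l x'))).
Qed.

(** * Sparsity and uniqueness in general position *)

(** The variational inequality along the [j]-th coordinate axis: unit steps bound
    the correlation by [l], and the step that sends [x j 0] to zero shows that
    the bound is attained. *)
Lemma lasso_sol_equicorrelation (R : realType) (m n : nat) (A : 'M[R]_(m, n))
    (y : 'cV[R]_m) (l : R) (x : 'cV[R]_n) (j : 'I_n) : 0 <= l ->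
  lasso_sol A y l x -> x j 0 != 0 -> `|dot (col j A) (y - A *m x)| = l.
Proof.
move=> l0 /(lassoP _ _ _ l0) vi xj.
have move_coord t : t * dot (col j A) (y - A *m x) <=
    l * (`|x j 0 + t| - `|x j 0|).
  have := vi (x + t *: delta_mx j 0).
  rewrite mulmxDr addrAC subrr add0r -scalemxAr -colE dotZr dotC.
  suff -> : l1norm (x + t *: delta_mx j 0) - l1norm x = `|x j 0 + t| - `|x j 0|.
    exact.
  rewrite /l1norm -sumrB (bigD1 j)//= !mxE !eqxx mulr1 big1 ?addr0// => i ij.
  by rewrite !mxE (negbTE ij) mulr0 addr0 subrr.
apply/eqP; rewrite eq_le; apply/andP; split.
- rewrite ler_norml; have := move_coord 1; have := move_coord (-1).
  have := ler_normD (x j 0) 1; have := ler_normB (x j 0) 1; rewrite normr1.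
  move=> h1 h2; have /(ler_wpM2l l0) := h1; have /(ler_wpM2l l0) := h2; lra.
- have := move_coord (- x j 0); rewrite subrr normr0 sub0r mulNr mulrN lerN2.
  move/le_trans/(_ (ler_norm _)); rewrite normrM mulrC ler_pM2l//.
  by rewrite normr_gt0.
Qed.

Lemma free_size_le (R : realType) (m : nat) (s : seq 'cV[R]_m) :
  free s -> (size s <= m)%N.
Proof.
rewrite /free => /eqP <-; apply: leq_trans (dimvS (subvf _)) _.
by rewrite dimvf /dim /= muln1.
Qed.

Lemma free_sum_eq0 (K : fieldType) (vT : vectType K) (I : eqType) (p : I -> vT)
    (c : I -> K) (t : seq I) :
  free (map p t) -> \sum_(j <- t) c j *: p j = 0 -> {in t, forall j, c j = 0}.
Proof.
elim: t => [|i t IH] //=; rewrite free_cons big_cons => /andP[nin ft] s0.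
have ci : c i = 0.
  apply/eqP; apply: contraNT nin => ci.
  have -> : p i = - (c i)^-1 *: \sum_(j <- t) c j *: p j.
    move/eqP: s0; rewrite addr_eq0 => /eqP s0.
    by rewrite -[X in _ = _ *: X]opprK -s0 scaleNr scalerN opprK scalerA mulVf ?scale1r.
  rewrite memvZ// big_seq memv_suml// => j jt.
  by rewrite memvZ// memv_span// map_f.
move: s0; rewrite ci scale0r add0r => s0 j; rewrite inE => /predU1P[->//|jt].
exact: IH.
Qed.

(** The sign makes the correlation with [e] nonnegative; it is the choice of signs
    at which general position is applied. *)
Definition aligned_col (R : realType) (m n : nat) (A : 'M[R]_(m, n))
    (e : 'cV[R]_m) (j : 'I_n) : 'cV[R]_m :=
  (-1) ^+ (dot (col j A) e < 0)%R *: col j A.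

(** If an aligned column were a combination of independent aligned columns, the
    inner product with [e] would give [l] times the sum of the coefficients
    equal to [l].  The combination would then be affine, against general
    position; independence keeps the number of columns within [m]. *)
Lemma general_position_free (R : realType) (m n : nat) (A : 'M[R]_(m, n))
    (e : 'cV[R]_m) (l : R) (t : seq 'I_n) : 0 < l -> general_position A ->
  uniq t -> {in t, forall j, `|dot (col j A) e| = l} ->
  free (map (aligned_col A e) t).
Proof.
set p := aligned_col A e; move=> l0 gp.
elim: t => [|i t IH] /= => [_ _|]; first exact: nil_free.
move=> /andP[it ut] equi.
have ft : free (map p t).
  by apply: IH => // j jt; apply: equi; rewrite inE jt orbT.
rewrite free_cons ft andbT; apply/negP => /(free_span ft)[k pk _].
have pE j : j \in i :: t -> dot (p j) e = l.
  move=> jt; rewrite /p /aligned_col dotZl -(equi j jt).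
  by case: (ltrP (dot (col j A) e) 0) => h; rewrite ?expr1 ?expr0 ?mulN1r ?mul1r
    ?(ltr0_norm h) ?(ger0_norm h).
have tE (V : nmodType) (F : 'I_n -> V) :
    \sum_(j <- t) F j = \sum_(j in [set j in t]%SET) F j.
  by rewrite big_uniq//=; apply: eq_bigl => j; rewrite inE.
apply: (gp [set j in t]%SET i (fun j => dot (col j A) e < 0)).
- by rewrite cardsE (card_uniqP ut) -(size_map p) free_size_le.
- by rewrite finset.in_set.
- exists (fun j => k (p j)); rewrite -!tE; move: pk; rewrite big_map => pk.
  split=> //; apply: (mulIf (lt0r_neq0 l0)); rewrite mul1r.
  rewrite -[RHS](pE i (mem_head _ _)) pk mulr_suml.
  rewrite /dot raddf_sum /= mulmx_suml summxE big_seq [RHS]big_seq.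
  apply: eq_bigr => j jt; rewrite -/(dot (k (p j) *: p j) e) dotZl pE//.
  by rewrite inE jt orbT.
Qed.

Lemma mulmx_sum_col (R : realType) (m n : nat) (A : 'M[R]_(m, n)) (x : 'cV[R]_n) :
  A *m x = \sum_j x j 0 *: col j A.
Proof.
apply/colP => i; rewrite mxE summxE; apply: eq_bigr => j _.
by rewrite !mxE mulrC.
Qed.

(** All solutions have the same residual, hence are supported on the same set [t]
    of equicorrelated columns.  These are independent, so the common fit
    determines the solution. *)
Lemma lasso_sol_general_position (R : realType) (m n : nat) (A : 'M[R]_(m, n))
    (y : 'cV[R]_m) (l : R) : 0 < l -> general_position A ->
  exists x, lasso_sol A y l = [set x] /\ (nnz x <= minn m n)%N.
Proof.
move=> l0 gp; have [x sx] := lasso_sol_neq0 A y l0.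
have supp x' j : lasso_sol A y l x' -> x' j 0 != 0 ->
    `|dot (col j A) (y - A *m x)| = l.
  move=> sx' xj; have [-> _] := lasso_sol_fit l0 sx sx'.
  exact: lasso_sol_equicorrelation (ltW l0) sx' xj.
exists x; split; last first.
  rewrite leq_min; apply/andP; split; last first.
    by apply: leq_trans (max_card _) _; rewrite card_ord.
  rewrite /nnz cardE -(size_map (aligned_col A (y - A *m x))).
  apply/free_size_le/(general_position_free l0 gp); first exact: enum_uniq.
  by move=> j; rewrite mem_enum inE; exact: supp.
apply/seteqP; split=> [x' sx' /=|_ ->//].
have [fit _] := lasso_sol_fit l0 sx sx'.
pose t := [seq j <- enum 'I_n | `|dot (col j A) (y - A *m x)| == l].
have ut : uniq t by rewrite filter_uniq// enum_uniq.
have ft : free (map (aligned_col A (y - A *m x)) t).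
  apply: (general_position_free l0 gp) => //.
  by move=> j; rewrite mem_filter => /andP[/eqP].
apply/colP => j; apply/eqP; rewrite -subr_eq0; apply/eqP.
have off i : i \notin t -> x' i 0 - x i 0 = 0.
  rewrite mem_filter mem_enum andbT => it.
  have z x'' : lasso_sol A y l x'' -> x'' i 0 = 0.
    by move=> s''; apply/eqP; apply: contraNT it => /(supp _ _ s'')/eqP.
  by rewrite !z// subrr.
have [jt|/off//] := boolP (j \in t).
pose c i := (-1) ^+ (dot (col i A) (y - A *m x) < 0)%R * (x' i 0 - x i 0).
suff /(free_sum_eq0 ft)/(_ j jt)/eqP :
    \sum_(i <- t) c i *: aligned_col A (y - A *m x) i = 0.
  by rewrite mulf_eq0 signr_eq0 /= => /eqP.
transitivity (A *m (x' - x)); last by rewrite mulmxBr fit subrr.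
rewrite (big_uniq _ ut) /= [RHS]mulmx_sum_col.
rewrite [RHS](bigID (mem t)) /=.
rewrite [X in _ = _ + X]big1 ?addr0; last first.
  by move=> i /off d; rewrite !mxE d scale0r.
apply: eq_bigr => i _.
by rewrite /aligned_col scalerA /c mulrAC -expr2 sqrr_sign mul1r !mxE.
Qed.

Lemma general_positionZ (R : realType) (m n : nat) (A : 'M[R]_(m, n)) (c : R) :
  c != 0 -> general_position A -> general_position (c *: A).
Proof.
move=> c0 gp I i s Im iI [k [k1 kE]]; apply: (gp I i s Im iI); exists k.
split=> //; apply: (scalerI c0).
have colZ j : (-1) ^+ s j *: col j (c *: A) = c *: ((-1) ^+ s j *: col j A).
  by rewrite linearZ /= !scalerA mulrC.
rewrite -colZ kE scaler_sumr; apply: eq_bigr => j _.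
by rewrite colZ [LHS]scalerA (mulrC (k j)) -scalerA.
Qed.

Lemma lasso_sol_zero_design (R : realType) (m n : nat)
    (y : 'cV[R]_m) (l : R) : 0 < l ->
  lasso_sol (0 : 'M[R]_(m, n)) y l = [set 0].
Proof.
move=> l0; have Z x : lasso_sol (0 : 'M[R]_(m, n)) y l x -> x = 0.
  move=> /(_ 0); rewrite !mul0mx lerD2l ler_pM2l// l1norm0; exact: l1norm_eq0.
apply/seteqP; split=> [x /Z //|_ ->].
by have [x sx] := lasso_sol_neq0 (0 : 'M[R]_(m, n)) y l0; rewrite -(Z x sx).
Qed.

(** * Saddle points and the two one-sided problems *)

(** The value at one saddle point is the value of both one-sided problems, which
    turns the extended-real [argmin] sets into plain inequalities. *)
Lemma saddle_point_argmin (R : realType) (X Z : Type) (f : X -> Z -> R)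
    (x0 : X) (z0 : Z) : saddle_point f x0 z0 ->
  [/\ argmin (fun x => ereal_sup (range (fun z => (f x z)%:E))) =
        [set x | forall z, f x z <= f x0 z0],
      argmin (fun z => (- ereal_inf (range (fun x => (f x z)%:E)))%E) =
        [set z | forall x, f x0 z0 <= f x z] &
      forall x z, saddle_point f x z <->
        (forall z', f x z' <= f x0 z0) /\ (forall x', f x0 z0 <= f x' z)].
Proof.
move=> [sz sx]; split.
- apply/seteqP; split=> x /= hx.
    move=> z; rewrite -lee_fin.
    have : (ereal_sup (range (fun z => (f x z)%:E)) <= (f x0 z0)%:E)%E.
      by apply: le_trans (hx x0) _; apply: ge_ereal_sup => _ [z' _ <-]; rewrite lee_fin.
    by apply: le_trans; apply: ereal_sup_ubound; exists z.
  move=> x'; apply: (@le_trans _ _ (f x0 z0)%:E).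
    by apply: ge_ereal_sup => _ [z' _ <-]; rewrite lee_fin.
  apply: (@le_trans _ _ (f x' z0)%:E); first by rewrite lee_fin.
  by apply: ereal_sup_ubound; exists z0.
- apply/seteqP; split=> z /= hz.
    move=> x; rewrite -lee_fin.
    have : ((f x0 z0)%:E <= ereal_inf (range (fun x => (f x z)%:E)))%E.
      rewrite -leeN2; apply: le_trans (hz z0) _; rewrite leeN2.
      by apply: le_ereal_inf_tmp => _ [z' _ <-]; rewrite lee_fin.
    by move/le_trans; apply; apply: ereal_inf_lbound; exists x.
  move=> z'; rewrite leeN2; apply: (@le_trans _ _ (f x0 z0)%:E).
    apply: (@le_trans _ _ (f x0 z')%:E); last by rewrite lee_fin.
    by apply: ereal_inf_lbound; exists x0.
  by apply: le_ereal_inf_tmp => _ [x' _ <-]; rewrite lee_fin.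
- move=> x z; split=> [[hz hx]|[hx hz]].
    have e : f x z = f x0 z0.
      apply/eqP; rewrite eq_le.
      by rewrite (le_trans (hx x0) (sz z)) (le_trans (sx x) (hz z0)).
    by split=> t; rewrite -e.
  have e : f x z = f x0 z0 by apply/eqP; rewrite eq_le hx hz.
  by split=> t; rewrite e.
Qed.

(** * Existence of sGMC saddle points *)

Section sGMC.
Context (R : realType) (m n : nat) (A : 'M[R]_(m, n)) (rho : R).
Context (y r : 'cV[R]_m) (lambda : R).
Hypotheses (rho_ge0 : 0 <= rho) (rho_lt1 : rho < 1) (lambda_gt0 : 0 < lambda).

Local Notation s := (Num.sqrt rho).
Local Notation G := (sGMC A rho y r lambda).

Definition primal_lasso (v : 'cV[R]_m) : set 'cV[R]_n :=
  lasso_sol A ((1 - rho)^-1 *: (y - rho *: v)) (lambda / (1 - rho)).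

Definition dual_lasso (u : 'cV[R]_m) : set 'cV[R]_n :=
  lasso_sol (s *: A) (r + s *: u) lambda.

Lemma sGMCE x z : G x z =
  2^-1 * dot (y - A *m x) (y - A *m x) + lambda * l1norm x - lambda * l1norm z
  - rho / 2 * dot (A *m x - A *m z) (A *m x - A *m z) + s * dot r (A *m z).
Proof. by rewrite /sGMC !sqr_l2norm -mulmxA. Qed.

Let one_sub_rho : 0 < 1 - rho.
Proof. by rewrite subr_gt0. Qed.

Let sqr_s : s * s = rho.
Proof. by rewrite -expr2 sqr_sqrtr. Qed.

(** The normalization by [1 - rho] is cleared, so that this inequality can be
    compared with the one of an unnormalized LASSO. *)
Lemma primal_lassoP v x : primal_lasso v x <->
  forall x', dot (y - rho *: v - (1 - rho) *: (A *m x)) (A *m x' - A *m x) <=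
             lambda * (l1norm x' - l1norm x).
Proof.
have e : y - rho *: v - (1 - rho) *: (A *m x) =
    (1 - rho) *: ((1 - rho)^-1 *: (y - rho *: v) - A *m x).
  by rewrite [RHS]scalerBr scalerA divff ?scale1r// gt_eqF.
rewrite /primal_lasso lassoP; last by rewrite divr_ge0// ltW.
have scale x' : (dot (y - rho *: v - (1 - rho) *: (A *m x)) (A *m x' - A *m x)
      <= lambda * (l1norm x' - l1norm x)) =
    (dot ((1 - rho)^-1 *: (y - rho *: v) - A *m x) (A *m x' - A *m x)
      <= lambda / (1 - rho) * (l1norm x' - l1norm x)).
  by rewrite e dotZl -ler_pdivlMl// mulrA (mulrC lambda).
by split=> h x'; have := h x'; rewrite scale.
Qed.

Lemma sGMC_subl x x' z : G x' z - G x z =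
  (1 - rho) *
  (lasso A ((1 - rho)^-1 *: (y - rho *: (A *m z))) (lambda / (1 - rho)) x' -
   lasso A ((1 - rho)^-1 *: (y - rho *: (A *m z))) (lambda / (1 - rho)) x).
Proof.
rewrite lasso_sub !sGMCE !dot_expand.
rewrite !(dotC _ y) !(dotC _ (A *m z)) (dotC (A *m x') (A *m x)).
by field; rewrite gt_eqF.
Qed.

Lemma sGMC_subr x z z' : G x z' - G x z =
  lasso (s *: A) (r + s *: (A *m x)) lambda z -
  lasso (s *: A) (r + s *: (A *m x)) lambda z'.
Proof.
apply: oppr_inj; rewrite opprB [RHS]opprB lasso_sub !sGMCE -!scalemxAl !dot_expand.
rewrite !(dotC _ (A *m x)) (dotC (A *m z') (A *m z)).
move: (s) sqr_s => t <-; lra.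
Qed.

Lemma saddle_pointP x z : saddle_point G x z <->
  primal_lasso (A *m z) x /\ dual_lasso (A *m x) z.
Proof.
split=> [[hz hx]|[hx hz]]; split=> t.
- have := hx t; rewrite -subr_ge0 sGMC_subl pmulr_rge0// subr_ge0; exact.
- have := hz t; rewrite -subr_le0 sGMC_subr subr_le0; exact.
- by rewrite -subr_le0 sGMC_subr subr_le0; exact: hz.
- by rewrite -subr_ge0 sGMC_subl pmulr_rge0// subr_ge0; exact: hx.
Qed.

(** [V] is the value of the inner maximization, up to sign and to terms that are
    affine in [A x]; [e x] is its gradient in the data [r + s A x].  A minimizer of the primal objective
    [P] also minimizes the majorant of [P] obtained by linearizing [V] there. *)
Lemma saddle_point_ex : exists x z, saddle_point G x z.
Proof.
have [zf zfP] : exists zf : 'cV[R]_n -> 'cV[R]_n,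
    forall x, dual_lasso (A *m x) (zf x).
  have ne x : {z | dual_lasso (A *m x) z}.
    exact/cid/lasso_sol_neq0.
  by exists (fun x => projT1 (ne x)) => x; exact: projT2 (ne x).
pose V x := lasso (s *: A) (r + s *: (A *m x)) lambda (zf x).
pose e x := r + s *: (A *m x) - s *: A *m zf x.
have VP x x' : dot (e x) (s *: (A *m x' - A *m x)) <= V x' - V x <=
    dot (e x) (s *: (A *m x' - A *m x)) +
    2^-1 * dot (s *: (A *m x' - A *m x)) (s *: (A *m x' - A *m x)).
  have := lasso_value_lin (ltW lambda_gt0) (zfP x') (zfP x).
  have -> // : r + s *: (A *m x') - (r + s *: (A *m x)) = s *: (A *m x' - A *m x).
  by rewrite opprD addrACA subrr add0r scalerBr.
have cA : continuous (fun x : 'cV[R]_n => A *m x) by exact: continuous_mulmx.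
have cst (T : topologicalType) (c : T) :
  continuous (fun _ : 'cV[R]_n => c) by exact: cst_continuous.
have cV : continuous V.
  move=> x.
  pose q1 x' := dot (e x) (s *: (A *m x' - A *m x)).
  pose q2 x' := q1 x' +
    2^-1 * dot (s *: (A *m x' - A *m x)) (s *: (A *m x' - A *m x)).
  have cd : continuous (fun x' => s *: (A *m x' - A *m x)).
    by apply: continuous_scale; apply: continuous_sub; [exact: cA|exact: cst].
  have cq1 : continuous (fun x' => V x + q1 x').
    by apply: continuous_add; [exact: cst|apply: continuous_dot; [exact: cst|exact: cd]].
  have cq2 : continuous (fun x' => V x + q2 x').
    apply: continuous_add; [exact: cst|apply: continuous_add].
      by apply: continuous_dot; [exact: cst|exact: cd].
    by apply: continuous_mull; apply: continuous_dot; exact: cd.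
  have := cq1 x; have := cq2 x.
  rewrite /continuous_at /q2 /q1 !subrr scaler0 !dot0r mulr0 !addr0 => l2 l1.
  apply: (squeeze_cvgr _ l1 l2); apply: nearW => x'.
  by rewrite -lerBrDl -(lerBlDl _ (V x)); exact: VP.
pose P x := 2^-1 * dot (y - A *m x) (y - A *m x) + lambda * l1norm x
  + s * dot r (A *m x) - V x.
have cP : continuous P.
  have cy : continuous (fun x : 'cV[R]_n => y - A *m x).
    by apply: continuous_sub; [exact: cst|exact: cA].
  apply: continuous_sub; last exact: cV.
  apply: continuous_add; [apply: continuous_add|].
  - by apply: continuous_mull; apply: continuous_dot; exact: cy.
  - by apply: continuous_mull; exact: continuous_l1norm.
  - by apply: continuous_mull; apply: continuous_dot; [exact: cst|exact: cA].
have [x xmin] : argmin P !=set0.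
  apply: (@coercive_min _ _ _ lambda (2^-1 * (dot y y / (1 - rho) + dot r r))
    lambda_gt0 cP) => x.
  have := zfP x 0; rewrite -/(lasso _ _ _ _) -/(V x) mulmx0 l1norm0 sqr_l2norm.
  have := completed_square_ge0 y (A *m x) one_sub_rho.
  rewrite /P subr0 !dot_expand !(dotC (A *m x) y) !(dotC (A *m x) r).
  have := dot_ge0 y; move: (s) sqr_s => t <-; lra.
exists x; exists (zf x); apply/saddle_pointP; split=> //.
apply/primal_lassoP.
(* Minimality of [x] for the majorant.  The data carry the extra term
   [rho A x], which turns the residual [y - A x] into
   [y - (1 - rho) A x], as in [primal_lassoP]. *)
have /lassoP : lasso_sol A (y - rho *: (A *m zf x - A *m x)) lambda x.
  move=> x'; rewrite -/(lasso _ _ _ _) -[leRHS]/(lasso _ _ _ _).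
  have := xmin x'; have /andP[+ _] := VP x x'.
  rewrite /P /lasso !sqr_l2norm /e -scalemxAl !dot_expand.
  rewrite !(dotC _ y) !(dotC _ (A *m zf x)) (dotC (A *m x') (A *m x)).
  move: (s) sqr_s => t <-; lra.
move=> /(_ (ltW lambda_gt0)) h x'; have := h x'.
have -> : y - rho *: (A *m zf x - A *m x) - A *m x =
          y - rho *: (A *m zf x) - (1 - rho) *: (A *m x).
  by rewrite scalerBr scalerBl scale1r opprB opprB; apply/colP => i; rewrite !mxE; ring.
exact.
Qed.
End sGMC.

(** * The sGMC solution sets *)

Section sGMC_sol.
Context (R : realType) (m n : nat) (A : 'M[R]_(m, n)) (rho : R).
Context (y r : 'cV[R]_m) (lambda : R).
Hypotheses (rho_ge0 : 0 <= rho) (rho_lt1 : rho < 1) (lambda_gt0 : 0 < lambda).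

Local Notation s := (Num.sqrt rho).
Local Notation G := (sGMC A rho y r lambda).
Local Notation Sp := (primal_sol A rho y r lambda).
Local Notation Sd := (dual_sol A rho y r lambda).
Local Notation Se := (extended_sol A rho y r lambda).
Local Notation Lp := (primal_lasso A rho y lambda).
Local Notation Ld := (dual_lasso A rho r lambda).

Let lambda1_gt0 : 0 < lambda / (1 - rho).
Proof. by rewrite divr_gt0// subr_gt0. Qed.

Lemma saddle_point_solP x z : saddle_point G x z <-> Sp x /\ Sd z.
Proof.
have [x0 [z0 xz0]] := saddle_point_ex A y r rho_ge0 rho_lt1 lambda_gt0.
have [pE dE ->] := saddle_point_argmin xz0.
by rewrite /primal_sol pE /dual_sol dE.
Qed.

Lemma sol_lassoP x z : Sp x -> Sd z -> Lp (A *m z) x /\ Ld (A *m x) z.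
Proof. by move=> px dz; apply/saddle_pointP => //; apply/saddle_point_solP. Qed.

Lemma sol_ex : exists x z, Sp x /\ Sd z.
Proof.
have [x [z /saddle_point_solP xz]] := saddle_point_ex A y r rho_ge0 rho_lt1 lambda_gt0.
by exists x; exists z.
Qed.

(** All points of [primal_lasso (A z)] have the fit of one primal solution, and
    [dual_lasso (A x)] depends on [x] through its fit only: replacing [x] keeps
    the pair a saddle point. *)
Lemma primal_solE z : Sd z -> Sp = Lp (A *m z).
Proof.
move=> dz; have [x0 [_ [px0 _]]] := sol_ex.
have [lx0 lz] := sol_lassoP px0 dz.
apply/seteqP; split=> x; first by move=> px; have [] := sol_lassoP px dz.
move=> lx; have [fit _] := lasso_sol_fit lambda1_gt0 lx lx0.
suff [] : Sp x /\ Sd z by [].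
by apply/saddle_point_solP/saddle_pointP => //; rewrite fit.
Qed.

(** As for [primal_solE], but the common fit is only that of [sqrt rho A]; this
    suffices because [primal_lasso] depends on [rho A z] only. *)
Lemma dual_solE x : Sp x -> Sd = Ld (A *m x).
Proof.
move=> px; have [_ [z0 [_ dz0]]] := sol_ex.
have [lx lz0] := sol_lassoP px dz0.
apply/seteqP; split=> z; first by move=> dz; have [] := sol_lassoP px dz.
move=> lz; have [fit _] := lasso_sol_fit lambda_gt0 lz lz0.
suff [] : Sp x /\ Sd z by [].
apply/saddle_point_solP/saddle_pointP => //; split=> //.
have -> // : Lp (A *m z) = Lp (A *m z0).
move: fit; rewrite -!scalemxAl /primal_lasso => fit.
by rewrite -(sqr_sqrtr rho_ge0) expr2 -!scalerA fit.
Qed.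

Lemma extended_solE : Se = stackX Sp Sd.
Proof. by apply/seteqP; split=> w /saddle_point_solP. Qed.

Lemma dual_lasso_rho0 u : rho = 0 -> Ld u = [set 0].
Proof.
by move=> r0; rewrite /dual_lasso r0 sqrtr0 scale0r lasso_sol_zero_design.
Qed.

(** For [rho = 0] the dual LASSO sees no fit at all, but then its only solution is
    zero. *)
Lemma dual_sol_fit z1 z2 : Sd z1 -> Sd z2 ->
  A *m z1 = A *m z2 /\ l1norm z1 = l1norm z2.
Proof.
have [x [_ [px _]]] := sol_ex; rewrite (dual_solE px).
have [r0|r0] := eqVneq rho 0; first by rewrite dual_lasso_rho0// => -> ->.
move=> s1 s2; have [fit ->] := lasso_sol_fit lambda_gt0 s1 s2; split=> //.
move: fit; rewrite -!scalemxAl; apply: scalerI.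
by rewrite sqrtr_eq0 -ltNge lt_neqAle eq_sym r0.
Qed.

(** A saddle point satisfies [G x 0 <= G 0 z]; what remains on the right after
    moving the two norms to the left is bounded by completing squares in [A x]
    and in [A z].  This bounds even the sum of the norms. *)
Lemma sol_l1norm_le x z : Sp x -> Sd z ->
  l1norm x + l1norm z <=
  l2norm y ^+ 2 / (2 * lambda * (1 - rho)) + l2norm r ^+ 2 / (2 * lambda).
Proof.
move=> px dz; have /saddle_point_solP [/(_ 0) hz /(_ 0) hx] := conj px dz.
have := le_trans hz hx; rewrite !sGMCE !sqr_l2norm l1norm0 !mulmx0 => {hz hx}.
have r1 : 0 < 1 - rho by rewrite subr_gt0.
have hu := completed_square_ge0 y (A *m x) r1.
have hw := dot_ge0 (r - s *: (A *m z)).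
move=> h; rewrite -(ler_pM2l lambda_gt0).
have -> : lambda * (dot y y / (2 * lambda * (1 - rho)) + dot r r / (2 * lambda)) =
    2^-1 * (dot y y / (1 - rho) + dot r r).
  by field; rewrite !gt_eqF.
move: h hu hw; rewrite !dot_expand !(dotC _ y) !(dotC _ r).
have := sqr_sqrtr rho_ge0; rewrite expr2; move: s => t <-; lra.
Qed.
End sGMC_sol.

(** * Stacked solution sets *)

Lemma stackX_closed (R : realType) (n : nat) (P Q : set 'cV[R]_n) :
  closed P -> closed Q -> closed (stackX P Q).
Proof.
move=> cP cQ; have -> : stackX P Q = (@usubmx R n n 1 @^-1` P) `&` (@dsubmx R n n 1 @^-1` Q).
  by [].
have cu : continuous (@usubmx R n n 1).
  apply: continuous_coordwise => i j.
  have -> : (fun w : 'cV[R]_(n + n) => usubmx w i j) = (fun w => w (lshift n i) j).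
    by apply/funext => w; rewrite mxE.
  exact: coord_continuous.
have cd : continuous (@dsubmx R n n 1).
  apply: continuous_coordwise => i j.
  have -> : (fun w : 'cV[R]_(n + n) => dsubmx w i j) = (fun w => w (rshift n i) j).
    by apply/funext => w; rewrite mxE.
  exact: coord_continuous.
move/continuous_closedP in cu; move/continuous_closedP in cd.
by apply: closedI; [exact: cu|exact: cd].
Qed.

Lemma stackX_convex (R : realType) (n : nat) (P Q : set 'cV[R]_n) :
  convex_set P -> convex_set Q -> convex_set (stackX P Q).
Proof.
move=> cP cQ w1 w2 t; rewrite !inE => -[p1 q1] [p2 q2]; split.
- have := cP _ _ t (mem_set p1) (mem_set p2); rewrite inE.
  by rewrite /conv /= linearD !linearZ.
- have := cQ _ _ t (mem_set q1) (mem_set q2); rewrite inE.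
  by rewrite /conv /= linearD !linearZ.
Qed.

Lemma l1norm_stack (R : realType) (n : nat) (w : 'cV[R]_(n + n)) :
  l1norm w = l1norm (usubmx w) + l1norm (dsubmx w).
Proof.
rewrite /l1norm big_split_ord /=.
by congr (_ + _); apply: eq_bigr => i _; rewrite mxE.
Qed.

Theorem theorem1 (R : realType) (m n : nat) (hm : (0 < m)%N) (hn : (0 < n)%N)
    (A : 'M[R]_(m, n)) (rho : R) (y r : 'cV[R]_m) (lambda : R)
    (hrho0 : 0 <= rho) (hrho1 : rho < 1) (hlambda : 0 < lambda) :
  let Sp := primal_sol A rho y r lambda in
  let Sd := dual_sol A rho y r lambda in
  let Se := extended_sol A rho y r lambda in
  [/\ Sp !=set0, closed Sp, convex_set Sp & bounded_set Sp] /\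
  [/\ Sd !=set0, closed Sd, convex_set Sd & bounded_set Sd] /\
  [/\ Se !=set0, closed Se, convex_set Se & bounded_set Se] /\
  ((forall x1 x2, Sp x1 -> Sp x2 ->
      A *m x1 = A *m x2 /\ l1norm x1 = l1norm x2) /\
   (forall z1 z2, Sd z1 -> Sd z2 ->
      A *m z1 = A *m z2 /\ l1norm z1 = l1norm z2)) /\
  (general_position A ->
     (exists x, Sp = [set x] /\ (nnz x <= minn m n)%N) /\
     (exists z, Sd = [set z] /\ (nnz z <= minn m n)%N)) /\
  (forall x z, Sp x -> Sd z ->
     Num.max (l1norm x) (l1norm z) <=
       l2norm y ^+ 2 / (2 * lambda * (1 - rho)) + l2norm r ^+ 2 / (2 * lambda)) /\
  (forall x z, Sp x -> Sd z ->
     let betap := A *m x in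
     let betad := A *m z in
     Se = stackX Sp Sd /\
     stackX Sp Sd =
       stackX
         (lasso_sol A ((1 - rho)^-1 *: (y - rho *: betad)) (lambda / (1 - rho)))
         (lasso_sol (Num.sqrt rho *: A) (r + Num.sqrt rho *: betap) lambda)).
Proof.
move=> Sp Sd Se.
have l1 : 0 < lambda / (1 - rho) by rewrite divr_gt0// subr_gt0.
have [x0 [z0 [px0 dz0]]] := sol_ex A y r hrho0 hrho1 hlambda.
have SpE : Sp = primal_lasso A rho y lambda (A *m z0) by exact: primal_solE.
have SdE : Sd = dual_lasso A rho r lambda (A *m x0) by exact: dual_solE.
have SeE : Se = stackX Sp Sd by exact: extended_solE.
have bound x z : Sp x -> Sd z -> l1norm x + l1norm z <=
    l2norm y ^+ 2 / (2 * lambda * (1 - rho)) + l2norm r ^+ 2 / (2 * lambda).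
  exact: sol_l1norm_le.
have pclosed : closed Sp by rewrite SpE; exact: lasso_sol_closed.
have dclosed : closed Sd by rewrite SdE; exact: lasso_sol_closed.
have pconvex : convex_set Sp by rewrite SpE; exact: lasso_sol_convex.
have dconvex : convex_set Sd by rewrite SdE; exact: lasso_sol_convex.
split; [|split; [|split; [|split; [|split; [|split]]]]].
- split=> //; first by exists x0.
  apply: bounded_l1 => x px; apply: le_trans (bound x z0 px dz0).
  by rewrite lerDl l1norm_ge0.
- split=> //; first by exists z0.
  apply: bounded_l1 => z dz; apply: le_trans (bound x0 z px0 dz).
  by rewrite lerDr l1norm_ge0.
- rewrite SeE; split; [|exact: stackX_closed|exact: stackX_convex|].
    by exists (col_mx x0 z0); rewrite /stackX /= col_mxKu col_mxKd.
  by apply: bounded_l1 => w [pw dw]; rewrite l1norm_stack; exact: bound.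
- split=> [x1 x2|]; last by move=> z1 z2; exact: dual_sol_fit.
  by rewrite SpE; exact: lasso_sol_fit.
- move=> gp; split; first by rewrite SpE; exact: lasso_sol_general_position.
  rewrite SdE; have [r0|r0] := eqVneq rho 0.
    exists 0; rewrite dual_lasso_rho0//; split=> //.
    by rewrite /nnz eq_card0// => i; rewrite !inE mxE eqxx.
  apply: lasso_sol_general_position => //; apply: general_positionZ => //.
  by rewrite sqrtr_eq0 -ltNge lt_neqAle eq_sym r0.
- move=> x z px dz; have := bound x z px dz; rewrite ge_max.
  have := l1norm_ge0 x; have := l1norm_ge0 z; lra.
- move=> x z px dz betap betad; split=> //.
  by rewrite {1}/Sp (primal_solE _ _ _ dz)// {1}/Sd (dual_solE _ _ _ px).
Qed.
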